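(* Let $M^0\in\mathbb{R}^{3\times3}$ with $\operatorname{tr}(M^0)=0$ have eigenvalues (counted with algebraic multiplicity) $\lambda_1,\lambda_2,\lambda_3\in\mathbb{C}$ with $$\operatorname{Re}(\lambda_1)<\operatorname{Re}(\lambda_2)\le\operatorname{Re}(\lambda_3),$$ and Jordan normal form $M^0=QJQ^{-1}$. Then the solution $M\in C^1\left([0,T_{max});\mathbb{R}^{3\times3}\right)$ of the matrix Navier--Stokes equation with initial data $M^0$ blows up in finite time $T_{max}<+\infty$, and has the form $$M(t)=QJ(t)Q^{-1},$$ where $$J(t)\sim\frac{1}{T_{max}-t}\begin{pmatrix}-2&0&0\\0&1&0\\0&0&1\end{pmatrix}\qquad\text{as } t\to T_{max}.$$
   Context: Matrix Navier--Stokes equation: $\partial_tM+M^2-\frac13\operatorname{tr}(M^2)I_3=0$, $\operatorname{tr}(M)=0$. $T_{max}$ denotes the maximal time of existence. The Jordan normal form is taken over $\mathbb{C}$ ($Q$ is an invertible, possibly complex, constant matrix), with Jordan blocks ordered so that the eigenvalue $\lambda_1$ occupies the first diagonal entry of $J$. The notation $J(t)\sim\frac{1}{T_{max}-t}D$ means $\lim_{t\to T_{max}}(T_{max}-t)J(t)=D$ entrywise. *)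

(* Defs.v *)
From HB Require Import structures.
From mathcomp Require Import all_boot all_order all_algebra.
From mathcomp Require Import complex.
From mathcomp Require Import all_classical all_reals all_analysis.

Set Implicit Arguments.
Unset Strict Implicit.
Unset Printing Implicit Defensive.

Import Order.TTheory GRing.Theory Num.Theory.
Import numFieldNormedType.Exports.

Local Open Scope classical_set_scope.
Local Open Scope ring_scope.

(* C is R[i] seen as a numFieldType, so that it carries the topology of its
   modulus (numFieldNormedType). *)
Definition C (R : realType) : numFieldType := R[i].

Definition toC (R : realType) (x : R) : C R := real_complex R x.

Definition jordan_block (F : fieldType) (k : nat) (a : F) : 'M[F]_k :=
  \matrix_(i, j) (a *+ (i == j) + (i.+1 == j :> nat)%:R).

Definition jordan_matrix (F : fieldType) (n : nat) (J : 'M[F]_n) : Prop :=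
  exists (r : nat) (k : 'I_r -> nat) (a : 'I_r -> F)
         (e : (\sum_b k b)%N = n),
    (forall b, (0 < k b)%N) /\
    J = castmx (e, e) (\mxdiag_b jordan_block (k b) (a b)).

Definition jordan_normal_form (F : fieldType) (n : nat) (A Q J : 'M[F]_n) :
    Prop :=
  [/\ Q \in unitmx, jordan_matrix J & A = Q *m J *m invmx Q].

Section NavierStokes.
Variable R : realType.

(* The interval [0, T), where T may be +oo. *)
Definition time_interval (T : \bar R) : set R :=
  [set t : R | 0 <= t /\ (t%:E < T)%E].

(* Derivative relative to D: one-sided at an endpoint of D that lies in D. *)
Definition is_derive_within (V : normedModType R) (D : set R) (f : R -> V)
    (t : R) (v : V) : Prop :=
  (s - t)^-1 *: (f s - f t) @[s --> within D t^'] --> v.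

(* f is C^1 on D with derivative df; only the values on D matter. *)
Definition C1_with_derivative (V : normedModType R) (D : set R)
    (f df : R -> V) : Prop :=
  (forall t, D t -> is_derive_within D f t (df t)) /\
  {within D, continuous df}.

Definition NS_solution (M0 : 'M[R]_3) (T : \bar R) (M : R -> 'M[R]_3) : Prop :=
  M 0 = M0 /\
  exists2 dM : R -> 'M[R]_3,
    C1_with_derivative (time_interval T) M dM &
    forall t, time_interval T t ->
      dM t + M t ^+ 2 - (3^-1 * \tr (M t ^+ 2)) *: 1%:M = 0 /\ \tr (M t) = 0.

(* Maximality is over all solutions with data M0, not only extensions of M. *)
Definition NS_maximal_solution (M0 : 'M[R]_3) (T : \bar R)
    (M : R -> 'M[R]_3) : Prop :=
  [/\ (0 < T)%E, NS_solution M0 T M &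
      forall (T' : \bar R) (M' : R -> 'M[R]_3),
        NS_solution M0 T' M' -> (T' <= T)%E].

End NavierStokes.

Definition blowup_profile (F : fieldType) : 'M[F]_3 :=
  \matrix_(i, j) ((if i == 0 then - 2 else 1) *+ (i == j)).

(* Main.v *)
Require Import Defs.
From HB Require Import structures.
From mathcomp Require Import all_boot all_order all_algebra.
From mathcomp Require Import complex.
From mathcomp Require Import all_classical all_reals all_analysis.
From mathcomp Require Import ring lra.

Set Implicit Arguments.
Unset Strict Implicit.
Unset Printing Implicit Defensive.

Import Order.TTheory GRing.Theory Num.Theory.
Import numFieldNormedType.Exports.

Local Open Scope classical_set_scope.
Local Open Scope ring_scope.

(** Write [S(N) = N^2 - (tr N^2 / 3) I], so that the equation is [M' = - S(M)],
    and let [A] be the initial matrix. Putting [M = Y' Y^-1] turns the Riccati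
    equation into [Y'' = (tr M^2 / 3) Y], whose coefficient is scalar; hence
    [Y = u (I + w A)] with scalar functions [u] and [w], and [tr M = 0] amounts
    to [det Y = 1]. With [P(w) = det (I + w A)] and [phi = 1 / u] this gives the
    closed form

      [M = (A - w S(A)) / phi], [phi^3 = P(w)], [w' = phi^2], [phi' = P'(w) / 3],

    which is verified directly from the Cayley-Hamilton theorem
    ([trfree_sqr_pencil], [explicit_solution]).

    The hypothesis on the real parts says that [lambda1 = - a] is real and
    negative and that [m = (lambda2 + a) * (lambda3 + a)] is positive
    ([eigenvalue_parameters]). So [w = 1 / a] is the first positive zero of [P],
    and it is simple; as the integral of [P^(-2/3)] up to a simple zero
    converges, [w] reaches [1 / a] at a finite time [T], where
    [phi] vanishes like [(m / (3 a)) (T - t)] ([clock]). Consequently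
    [(T - t) M] tends to [(3 / m) (a A - S(A))].

    In Jordan coordinates [A^2] is a combination of [A], the identity and the
    projector on the eigenvector of [lambda1] ([jordan3_projector]). In the
    residue the terms in [A] cancel, leaving [I - 3 E_00 = diag (-2, 1, 1)].

    Two solutions with the same data agree as long as both exist, by a Gronwall
    estimate on the squared Frobenius norm of their difference
    ([NS_solution_unique]). Hence no solution can live longer than the explicit
    one, which blows up, and every maximal solution coincides with it
    ([lifespan_le]). *)

(** * Entries of Jordan matrices *)

Lemma mxdiag_Rank (V : nmodType) r (k : 'I_r -> nat)
    (B : forall b, 'M[V]_(k b)) b (x y : 'I_(k b)) :
  (\mxdiag_b B b) (tagnat.Rank b x) (tagnat.Rank b y) = B b x y.
Proof. by have /matrixP/(_ x y) := submxblock_diag B b; rewrite [LHS]mxE. Qed.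

Lemma mxdiag_Rank_neq (V : nmodType) r (k : 'I_r -> nat)
    (B : forall b, 'M[V]_(k b)) b c (x : 'I_(k b)) (y : 'I_(k c)) :
  b != c -> (\mxdiag_b B b) (tagnat.Rank b x) (tagnat.Rank c y) = 0.
Proof.
by move=> bc; rewrite mxE ifF ?mxE// !tagnat.Rank1K; apply: negbTE.
Qed.

(** The only facts about the block structure that matter: a Jordan matrix is
    supported on the diagonal and the superdiagonal, and a superdiagonal one
    joins two equal diagonal entries. *)
Lemma jordan_matrix_entry (F : fieldType) n (J : 'M[F]_n) (i j : 'I_n) :
  jordan_matrix J -> J i j != 0 -> (i <= j <= i.+1)%N /\ J i i = J j j.
Proof.
case=> r [k [a [e [_ ->]]]]; rewrite !castmxE /=.
set i' := cast_ord _ i; set j' := cast_ord _ j.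
rewrite -[nat_of_ord i]/(nat_of_ord i') -[nat_of_ord j]/(nat_of_ord j').
rewrite -(tagnat.sig2K i') -(tagnat.sig2K j').
move: (tagnat.sig1 i') (tagnat.sig2 i') => b x.
move: (tagnat.sig1 j') (tagnat.sig2 j') => c y.
have [bc|bc] := eqVneq b c; last by rewrite mxdiag_Rank_neq ?eqxx.
move: x y; rewrite -{}bc => x y.
rewrite !(mxdiag_Rank (fun b => jordan_block (k b) (a b))) !mxE !eqxx !mulr1n.
rewrite !(gtn_eqF (ltnSn _)) !addr0 !tagnat.RankEsum => Bxy; split => //.
rewrite leq_add2l -addnS leq_add2l.
have [->|xy] := eqVneq x y; first by rewrite leqnn leqnSn.
have [<-|xy1] := eqVneq x.+1 y; first by rewrite leqnSn leqnn.
by move: Bxy; rewrite (negPf xy) (negPf xy1) mulr0n addr0 eqxx.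
Qed.

(** * Jordan forms of order three with a simple first eigenvalue *)

Lemma I3P (i : 'I_3) : [\/ i = 0, i = 1 | i = 2].
Proof.
by case: i => -[|[|[|//]]] i3; [constructor 1|constructor 2|constructor 3];
  apply: val_inj.
Qed.

Lemma sum3E (V : nmodType) (f : 'I_3 -> V) :
  \sum_(i < 3) f i = f 0 + f 1 + f 2.
Proof.
rewrite !big_ord_recl big_ord0 addr0 addrA.
by congr (_ + f _ + f _); apply: val_inj.
Qed.

Lemma prod3E (A : comNzRingType) (f : 'I_3 -> A) :
  \prod_(i < 3) f i = f 0 * f 1 * f 2.
Proof.
rewrite !big_ord_recl big_ord0 mulr1 mulrA.
by congr (_ * f _ * f _); apply: val_inj.
Qed.

Lemma char_poly_conj (F : fieldType) n (Q J : 'M[F]_n) :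
  Q \in unitmx -> char_poly (Q *m J *m invmx Q) = char_poly J.
Proof.
move=> Qu; have uQ : map_mx (@polyC F) Q \in unitmx by rewrite map_unitmx.
rewrite /char_poly.
have -> : char_poly_mx (Q *m J *m invmx Q) =
    map_mx polyC Q *m char_poly_mx J *m invmx (map_mx polyC Q).
  rewrite /char_poly_mx !map_mxM map_invmx mulmxBr mulmxBl; congr (_ - _).
  by rewrite scalar_mxC mulmxK.
rewrite !det_mulmx mulrAC -det_mulmx mulmxV //; first by rewrite det1 mul1r.
Qed.

Lemma char_poly_upper3 (F : fieldType) (J : 'M[F]_3) :
  (forall i j : 'I_3, (j < i)%N -> J i j = 0) ->
  char_poly J = \prod_(i < 3) ('X - (J i i)%:P).
Proof.
move=> upJ; have -> : char_poly J = char_poly J^T.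
  by rewrite /char_poly -det_tr; congr (\det _); apply/matrixP => i j;
     rewrite !mxE eq_sym.
rewrite char_poly_trig; first by apply: eq_bigr => i _; rewrite mxE.
by apply/is_trig_mxP => i j ij; rewrite mxE upJ.
Qed.

Section JordanForm3.
Variables (F : fieldType) (A Q J : 'M[F]_3) (l1 l2 l3 : F).
Hypotheses (l12 : l1 != l2) (l13 : l1 != l3).
Hypothesis cpA : char_poly A = ('X - l1%:P) * ('X - l2%:P) * ('X - l3%:P).
Hypotheses (jA : jordan_normal_form A Q J) (J00 : J 0 0 = l1).

(** The eigenvalue [l1] is simple, so its Jordan block has size one and [J]
    splits as a scalar and an upper triangular block. *)
Lemma jordan3_entries :
  [/\ forall i j : 'I_3, (j < i)%N -> J i j = 0, J 0 1 = 0, J 0 2 = 0,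
      J 1 1 + J 2 2 = l2 + l3 & J 1 1 * J 2 2 = l2 * l3].
Proof.
case: jA => Qu jJ AE.
have up (i j : 'I_3) : (j < i)%N -> J i j = 0.
  move=> ji; apply/eqP/negPn/negP => /(jordan_matrix_entry jJ)[/andP[ij _] _].
  by rewrite leqNgt ji in ij.
have : char_poly J = ('X - l1%:P) * ('X - l2%:P) * ('X - l3%:P).
  by rewrite -cpA AE char_poly_conj.
rewrite (char_poly_upper3 up) prod3E J00 -!mulrA.
move=> /(mulfI (negbT (polyXsubC_eq0 _))) cpE.
have ev x : (x - J 1 1) * (x - J 2 2) = (x - l2) * (x - l3).
  by have := congr1 (horner^~ x) cpE; rewrite !hornerE.
have prodE : J 1 1 * J 2 2 = l2 * l3 by have := ev 0; rewrite !sub0r !mulrNN.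
have sumE : J 1 1 + J 2 2 = l2 + l3.
  have -> : J 1 1 + J 2 2 =
      1 + J 1 1 * J 2 2 - (1 - J 1 1) * (1 - J 2 2) by ring.
  by rewrite prodE ev; ring.
split => //.
  apply/eqP/negPn/negP => /(jordan_matrix_entry jJ)[_]; rewrite J00 => J11.
  have := ev l1; rewrite -J11 subrr mul0r => /esym/eqP.
  by rewrite mulf_eq0 !subr_eq0 (negPf l12) (negPf l13).
by apply/eqP/negPn/negP => /(jordan_matrix_entry jJ)[/andP[]].
Qed.

Lemma jordan3_trace : \tr A = l1 + l2 + l3.
Proof.
have [up J01 J02 sumE prodE] := jordan3_entries; case: jA => Qu _ ->.
by rewrite mxtrace_mulC mulKmx // /mxtrace sum3E J00 -!addrA sumE.
Qed.

Lemma jordan3_trace_sqr : \tr (A ^+ 2) = l1 ^+ 2 + l2 ^+ 2 + l3 ^+ 2.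
Proof.
have [up J01 J02 sumE prodE] := jordan3_entries; case: jA => Qu _ ->.
rewrite expr2 -[_ * _]/(_ *m _) !mulmxA mulmxKV // mxtrace_mulC -!mulmxA mulKmx //.
rewrite /mxtrace sum3E !mxE !sum3E J00 J01 J02 !(up 1 0) // !(up 2 0) // !(up 2 1) //.
have -> : l2 ^+ 2 = (J 1 1 + J 2 2) ^+ 2 - J 1 1 * J 2 2 *+ 2 - l3 ^+ 2.
  rewrite sumE prodE; ring.
ring.
Qed.

(** By Cayley-Hamilton the lower right block is annihilated whether or not
    [l2] and [l3] coincide; this is why a nilpotent part of the initial data
    leaves no trace in the blowup profile. *)
Lemma jordan3_projector :
  (J - l2%:M) *m (J - l3%:M) = ((l1 - l2) * (l1 - l3)) *: delta_mx 0 0.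
Proof.
have [up J01 J02 sumE prodE] := jordan3_entries.
have J10 : J 1 0 = 0 by exact: up.
have J20 : J 2 0 = 0 by exact: up.
have J21 : J 2 1 = 0 by exact: up.
have l3E : l3 = J 1 1 + J 2 2 - l2 by rewrite sumE; ring.
have e2 : l2 ^+ 2 = (J 1 1 + J 2 2) * l2 - J 1 1 * J 2 2.
  by rewrite sumE prodE; ring.
apply/matrixP => i j; rewrite !mxE sum3E !mxE.
have [->|->|->] := I3P i; have [->|->|->] := I3P j;
  rewrite ?J00 ?J01 ?J02 ?J10 ?J20 ?J21 /= ?mulr1n ?mulr0n;
  first [ring|rewrite l3E; ring: e2].
Qed.
End JordanForm3.

(** * Solving a scalar autonomous equation by quadrature *)

Section Calculus.
Variable R : realType.
Implicit Types (f g h : R -> R) (x l : R).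

(** Solutions are defined through difference quotients restricted to an
    interval, whereas the rules of calculus speak of [is_derive]. *)
Lemma is_derive_quotient f x l :
  is_derive x 1 f l <-> (y - x)^-1 * (f y - f x) @[y --> x^'] --> l.
Proof.
split=> [/is_derive1_caratheodory[g [gE gc <-]]|fl].
  apply: cvg_trans (cvg_trans ((continuous_withinNx _ _).1 gc) _); last by [].
  apply: near_eq_cvg; near=> y; rewrite gE mulrCA mulVf ?mulr1 // subr_eq0.
  by near: y; exact: nbhs_dnbhs_neq.
apply/is_derive1_caratheodory.
exists (fun y => if y == x then l else (y - x)^-1 * (f y - f x)).
split; last by rewrite eqxx.
  move=> y; case: eqVneq => [->|yx]; first by rewrite !subrr mulr0.
  by rewrite mulrAC mulVf ?mul1r // subr_eq0.
apply/continuous_withinNx; rewrite eqxx; apply: cvg_trans fl.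
apply: near_eq_cvg; near=> y; rewrite ifN //.
by near: y; exact: nbhs_dnbhs_neq.
Unshelve. all: by end_near. Qed.

Lemma is_derive1_continuous f x l : is_derive x 1 f l -> {for x, continuous f}.
Proof.
by move=> /@ex_derive /derivable1_diffP; exact: differentiable_continuous.
Qed.

Lemma positive_primitive h (a b : R) : a < b -> continuous h ->
  (forall x, 0 < h x) ->
  exists F : R -> R, (forall x, a < x < b -> is_derive x 1 F (h x)) /\
    {in `]a, b[ &, {homo F : x y / x < y}}.
Proof.
move=> ab hc h0.
pose F x := (\int[lebesgue_measure]_(t in `[a, x]) h t)%R.
have dF x : a < x < b -> is_derive x 1 F (h x).
  case/andP=> ax xb.
  have ih : (lebesgue_measure : measure _ R).-integrable `[a, b] (EFin \o h).
    apply: continuous_compact_integrable; first exact: segment_compact.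
    exact/continuous_subspaceT.
  have [dFx Fx] := continuous_FTC1_closed xb ih ax (hc x).
  by rewrite -Fx derive1E; exact: DeriveDef.
exists F; split => //; apply: gtr0_derive1_lt_oo.
- by move=> x; rewrite in_itv => /dF/@ex_derive.
- by move=> x; rewrite in_itv => /dF xF; rewrite derive1E derive_val.
- by move=> x; rewrite inE/= in_itv => /dF/is_derive1_continuous.
Qed.

(** The equation [s' = - 1 / h s] is solved by inverting the time
    [G x = \int_x^1 h] needed to descend from [1] to [x]. The solution reaches
    [0] with the nonzero speed [1 / h 0], whence the last limit. *)
Lemma autonomous_decay h : continuous h -> (forall x, 0 < h x) ->
  exists (T : R) (s : R -> R), [/\ 0 < T, s 0 = 1,
    forall t, 0 <= t < T -> 0 < s t <= 1 /\ is_derive t 1 s (- (h (s t))^-1),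
    s t @[t --> T^'-] --> 0 & (T - t) / s t @[t --> T^'-] --> h 0].
Proof.
move=> hc h0.
(* Working on an interval larger than [0, 1] gives two-sided derivatives at
   both ends. *)
have [|F [dF Fincr]] := @positive_primitive h (-1) 2 _ hc h0.
  lra.
have Fc x : -1 < x < 2 -> {for x, continuous F}.
  by move=> /dF/is_derive1_continuous.
pose G x := F 1 - F x.
have Ginj x y : -1 < x < 2 -> -1 < y < 2 -> G x = G y -> x = y.
  move=> xI yI /addrI/oppr_inj Fxy.
  have [xy|yx|//] := ltgtP x y.
    by have := Fincr _ _ xI yI xy; rewrite Fxy ltxx.
  by have := Fincr _ _ yI xI yx; rewrite Fxy ltxx.
pose s t := xget 0 [set x | -1 < x < 2 /\ G x = t].
have sG x : -1 < x < 2 -> s (G x) = x.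
  move=> xI; rewrite /s; case: xgetP => [y -> [yI /Ginj]|/(_ x)]; first exact.
  by case; split.
have near12 x : -1 < x < 2 -> \forall y \near x, -1 < y < 2.
  move=> xI; have : x \in `]-1, 2[ by rewrite in_itv.
  by move=> /near_in_itvoo; apply: filterS => y; rewrite in_itv.
have ds x : -1 < x < 2 -> is_derive (G x) 1 s (- (h x)^-1).
  move=> xI; rewrite -invrN; apply: is_derive_inverse.
  - by near=> y; apply: sG; near: y; exact: near12.
  - near=> y; apply: cvgB; first exact: cvg_cst.
    by apply: Fc; near: y; exact: near12.
  - have dFx := dF _ xI.
    by rewrite -(sub0r (h x)); exact: is_deriveB.
  - by rewrite oppr_eq0 gt_eqF.
have G1 : G 1 = 0 by rewrite /G subrr.
have I0 : -1 < (0 : R) < 2 by lra.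
have I1 : -1 < (1 : R) < 2 by lra.
have s0 : s (G 0) = 0 by exact: sG.
have sT := ds _ I0.
have scT : s t @[t --> (G 0)^'-] --> 0.
  rewrite -[X in _ --> X]s0; apply: cvg_within_filter.
  exact: is_derive1_continuous sT.
exists (G 0), s; split => //.
- by rewrite /G subr_gt0 Fincr // in_itv.
- by rewrite -G1 sG.
- move=> t /andP[t0 tG].
  have [x xI Gxt] : exists2 x, x \in `[(0 : R), 1] & G x = t.
    apply: IVT => //.
      apply: continuous_in_subspaceT => x; rewrite inE/= in_itv/= => xI.
      by apply: cvgB; [exact: cvg_cst|apply: Fc; lra].
    by rewrite G1 ge_min t0 orbT le_max (ltW tG).
  move: xI; rewrite in_itv/= => xI.
  have x0 : x != 0 by apply: contraTneq tG => x0; rewrite -Gxt x0 ltxx.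
  have xI' : -1 < x < 2 by lra.
  rewrite -Gxt sG //; split; last exact: ds.
  by rewrite lt_def x0.
- move/is_derive_quotient : sT => /cvg_dnbhs_at_left.
  rewrite s0 => /(cvgV _); rewrite invrN oppr_eq0 invr_eq0 gt_eqF // => /(_ isT).
  rewrite invrK => /cvgN; rewrite opprK; apply: cvg_trans; apply: near_eq_cvg.
  by near=> t; rewrite !fctE /unstable.inv_fun subr0 invfM invrK -mulNr opprB.
Unshelve. all: by end_near. Qed.

End Calculus.

(** * The scalar functions of the closed form *)

Section Clock.
Variable R : realType.
Implicit Types (a m x w : R).

Lemma cube_rootK x : 0 < x -> (x `^ 3^-1) ^+ 3 = x.
Proof.
by move=> x0; rewrite -powR_mulrn ?powR_ge0 // -powRrM mulVf ?powRr1 ?ltW.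
Qed.

Lemma is_derive_cube_root (f : R -> R) (t df : R) : 0 < f t ->
  is_derive t 1 f df ->
  is_derive t 1 (fun u => f u `^ 3^-1) (df / (3 * (f t `^ 3^-1) ^+ 2)).
Proof.
move=> f0 fdf.
have dp : is_derive (f t) 1 (@powR R ^~ 3^-1) (3^-1 * f t `^ (3^-1 - 1)).
  exact: is_derive1_powR.
apply: (@is_derive_eq _ _ _ _ _ _ _ _ (is_derive1_comp dp fdf)).
have r0 : 0 < f t `^ 3^-1 by exact: powR_gt0.
have -> : f t `^ (3^-1 - 1) = f t `^ 3^-1 / (f t `^ 3^-1) ^+ 3.
  by rewrite cube_rootK // powRB ?powRr1 ?ltW // (gt_eqF f0) implybT.
move: (f t `^ 3^-1) r0 => r r0; rewrite /GRing.scale /=.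
by field; rewrite gt_eqF.
Qed.

(** This is [det (I + w A)] for [A] with eigenvalues [- a], [l2], [l3] subject
    to [l2 + l3 = a] and [l2 * l3 = m - 2 a^2], that is,
    [m = (l2 + a) * (l3 + a)]; for [a], [m > 0] its least positive
    zero is [1 / a]. *)
Definition cubic a m w : R :=
  1 + (m - 3 * a ^+ 2) * w ^+ 2 - a * (m - 2 * a ^+ 2) * w ^+ 3.

Definition dcubic a m w : R :=
  2 * (m - 3 * a ^+ 2) * w - 3 * a * (m - 2 * a ^+ 2) * w ^+ 2.

Lemma is_derive_cubic a m (f : R -> R) (t df : R) : is_derive t 1 f df ->
  is_derive t 1 (fun u => cubic a m (f u)) (dcubic a m (f t) * df).
Proof.
move=> fdf.
have dc : is_derive t 1 (cst (1 : R)) 0 by exact: is_derive_cst.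
have d2 := is_deriveZ (m - 3 * a ^+ 2) (is_deriveX 2 fdf).
have d3 := is_deriveZ (a * (m - 2 * a ^+ 2)) (is_deriveX 3 fdf).
apply: (is_derive_eq (is_deriveB (is_deriveD dc d2) d3)).
rewrite /GRing.scale /= /dcubic; ring.
Qed.

(** The system [w' = phi^2], [phi = (cubic w)^(1/3)] is a separable equation
    whose right-hand side is not Lipschitz at the zero [w = 1 / a] of [cubic].
    Since this zero is simple, the substitution [a w = 1 - s^3] removes the
    degeneracy: [cubic w = s^3 q(s^3)] with [q > 0] on [[0, 1]], and
    [s' = - (a / 3) q(s^3)^(2/3)] reaches [0] in finite time with nonzero
    speed. *)
Lemma clock a m : 0 < a -> 0 < m ->
  exists (T : R) (w phi : R -> R),
    [/\ 0 < T, w 0 = 0 /\ phi 0 = 1,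
      forall t, 0 <= t < T ->
        [/\ 0 < phi t, phi t ^+ 3 = cubic a m (w t),
            is_derive t 1 w (phi t ^+ 2) &
            is_derive t 1 phi (dcubic a m (w t) / 3)],
      w t @[t --> T^'-] --> a^-1 & (T - t) / phi t @[t --> T^'-] --> 3 * a / m].
Proof.
move=> a0 m0; have an0 : a != 0 by rewrite gt_eqF.
(* With [z = 1 - a w], this is [cubic w / z]. *)
pose q z : R := z ^+ 2 + 3 * z * (1 - z) + m / a ^+ 2 * (1 - z) ^+ 2.
have q0 z : 0 <= z <= 1 -> 0 < q z.
  case/andP=> z0 z1; rewrite /q.
  have mu0 : 0 < m / a ^+ 2 by rewrite divr_gt0 // exprn_gt0.
  have [->|zn1] := eqVneq z 1; first by rewrite expr1n subrr; lra.
  have z10 : 0 < 1 - z by rewrite subr_gt0 lt_neqAle zn1.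
  apply: ltr_wpDl; last by rewrite mulr_gt0 // exprn_gt0.
  by rewrite addr_ge0 ?sqr_ge0 // !mulr_ge0 // ltW.
(* Truncating the argument to [0, 1] makes the speed positive everywhere. *)
pose clip x : R := Num.max 0 (Num.min x 1).
have clipI x : 0 <= clip x ^+ 3 <= 1.
  have c0 : 0 <= clip x by rewrite le_max lexx.
  rewrite exprn_ge0 // exprn_ile1 // /clip.
  by rewrite ge_max ler01 ge_min lexx orbT.
pose k x : R := (q (clip x ^+ 3)) `^ 3^-1.
have k0 x : 0 < k x by apply: powR_gt0; exact: q0.
have clipc : continuous clip.
  move=> x; apply: (@continuous_max R R (cst 0) (fun y => Num.min y 1)).
    exact: cvg_cst.
  by apply: (@continuous_min R R id (cst 1)); [exact: cvg_id|exact: cvg_cst].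
have qc : continuous q.
  have -> : q = horner ('X^2 + 3%:P * 'X * (1 - 'X)
      + (m / a ^+ 2)%:P * (1 - 'X) ^+ 2).
    by apply/funext => z; rewrite /q !hornerE.
  exact: continuous_horner.
have kc : continuous k.
  move=> x; have Q0 : 0 < q (clip x ^+ 3) by exact: q0.
  have pc : {for q (clip x ^+ 3), continuous (@powR R ^~ 3^-1)}.
    exact: is_derive1_continuous (is_derive1_powR _ Q0).
  apply: (@continuous_comp _ _ _ (fun y => q (clip y ^+ 3)) (@powR R ^~ 3^-1));
    last exact: pc.
  apply: (@continuous_comp _ _ _ (fun y => clip y ^+ 3) q); last exact: qc.
  apply: (@continuous_comp _ _ _ clip (fun y => y ^+ 3)); first exact: clipc.
  exact: exprn_continuous.
pose h x : R := 3 / (a * k x ^+ 2).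
have hc : continuous h.
  move=> x; apply: cvgM; first exact: cvg_cst.
  apply: cvgV; first by rewrite mulf_neq0 // expf_neq0 // gt_eqF.
  apply: cvgM; first exact: cvg_cst.
  apply: (@continuous_comp _ _ _ k (fun y => y ^+ 2)); first exact: kc.
  exact: exprn_continuous.
have h0 x : 0 < h x by rewrite divr_gt0 // mulr_gt0 // exprn_gt0.
have [T [s [T0 s0 sI sT hT]]] := autonomous_decay hc h0.
pose w t : R := (1 - s t ^+ 3) / a.
pose phi t : R := cubic a m (w t) `^ 3^-1.
have cubicE t : cubic a m (w t) = s t ^+ 3 * q (s t ^+ 3).
  by rewrite /cubic /w /q; field.
have clipE x : 0 <= x <= 1 -> clip x = x.
  by case/andP=> x0 x1; rewrite /clip (min_idPl x1) (max_idPr x0).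
have cubic0 t : 0 <= t < T -> 0 < cubic a m (w t).
  move=> /sI[/andP[st0 st1] _].
  by rewrite cubicE mulr_gt0 ?exprn_gt0 // q0 // exprn_ge0 ?exprn_ile1 // ltW.
have phiE t : 0 <= t < T -> phi t = s t * k (s t).
  move=> /sI[/andP[st0 st1] _].
  have Q0 : 0 < q (s t ^+ 3) by rewrite q0 // exprn_ge0 ?exprn_ile1 // ltW.
  rewrite /phi cubicE powRM ?exprn_ge0 ?ltW // /k clipE ?(ltW st0) //.
  by rewrite -powR_mulrn ?ltW // -powRrM divff ?powRr1 // ltW.
have dw t : 0 <= t < T -> is_derive t 1 w (phi t ^+ 2).
  move=> tI; have [stI ds] := sI _ tI.
  have dc : is_derive t 1 (cst (1 : R)) 0 by exact: is_derive_cst.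
  have wE : w = a^-1 *: (cst 1 - s ^+ 3).
    by apply/funext => u; rewrite /w !fctE mulrC.
  rewrite wE; apply: (is_derive_eq (is_deriveZ a^-1 (is_deriveB dc (is_deriveX 3 ds)))).
  rewrite phiE // /h /GRing.scale /=; field.
  by rewrite an0 gt_eqF.
exists T, w, phi; split => //.
- by rewrite /phi /w s0 expr1n subrr mul0r /cubic !expr0n /= !mulr0 addr0 subr0 powR1.
- move=> t tI; have P0 := cubic0 _ tI.
  split; [exact: powR_gt0|exact: cube_rootK|exact: dw|].
  have dphi := is_derive_cube_root (f := fun u => cubic a m (w u)) P0
    (is_derive_cubic a m (dw _ tI)).
  apply: (@is_derive_eq _ _ _ phi _ _ _ _ dphi); rewrite -/(phi t); field.
  by rewrite gt_eqF // powR_gt0.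
- have -> : a^-1 = (1 - 0 ^+ 3) / a by rewrite expr0n subr0 mul1r.
  apply: cvgM; last exact: cvg_cst.
  apply: cvgB; first exact: cvg_cst.
  by apply: (cvg_comp _ (fun x => x ^+ 3) sT); exact: exprn_continuous.
- have ks : k (s t) @[t --> T^'-] --> k 0 by apply: (cvg_comp _ k sT); exact: kc.
  have hk : 3 * a / m = h 0 / k 0.
    have k03 : k 0 ^+ 3 = m / a ^+ 2.
      rewrite cube_rootK // ?q0 // /q clipE ?lexx ?ler01 //.
      by rewrite !expr0n /= !mulr0 mul0r subr0 expr1n mulr1 !add0r.
    have -> : m = a ^+ 2 * k 0 ^+ 3 by rewrite k03; field.
    by rewrite /h; field; rewrite an0 gt_eqF.
  rewrite hk.
  have lim : (T - t) / s t * (k (s t))^-1 @[t --> T^'-] --> h 0 / k 0.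
    by apply: cvgM hT _; apply: cvgV ks; rewrite lt0r_neq0.
  apply: cvg_trans lim; apply: near_eq_cvg; near=> t.
  rewrite /= phiE ?invfM ?mulrA //.
  apply/andP; split; near: t; [exact: nbhs_left_ge|exact: nbhs_left_lt].
Unshelve. all: by end_near. Qed.
End Clock.

(** * The closed form solves the matrix equation *)

Section ExplicitSolution.
Variables (R : realType) (A : 'M[R]_3) (a m : R).
Hypothesis cpA : char_poly A =
  'X^3 + (m - 3 * a ^+ 2)%:P * 'X + (a * (m - 2 * a ^+ 2))%:P.
Hypothesis trA : \tr A = 0.
Hypothesis trA2 : \tr (A ^+ 2) = 6 * a ^+ 2 - 2 * m.

(** The equation is [M' = - trfree_sqr M]. *)
Definition trfree_sqr (N : 'M[R]_3) : 'M[R]_3 :=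
  N ^+ 2 - (3^-1 * \tr (N ^+ 2)) *: 1%:M.

Lemma trace1 : \tr (1%:M : 'M[R]_3) = 3.
Proof. by rewrite mxtrace1. Qed.

Lemma trace_trfree_sqr N : \tr (trfree_sqr N) = 0.
Proof. by rewrite raddfB /= mxtraceZ trace1; lra. Qed.

Lemma trfree_sqrZ (x : R) N : trfree_sqr (x *: N) = x ^+ 2 *: trfree_sqr N.
Proof.
rewrite /trfree_sqr exprZn mxtraceZ scalerBr scalerA.
by congr (_ - _ *: _); ring.
Qed.

Lemma horner_mx_quadratic (k2 k1 k0 : R) :
  horner_mx A (k2%:P * 'X^2 + k1%:P * 'X + k0%:P) =
  k2 *: A ^+ 2 + k1 *: A + k0 *: 1%:M.
Proof.
rewrite !rmorphD !rmorphM /= !horner_mx_X !horner_mx_C expr2 -!mulmxE.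
by rewrite !mul_scalar_mx scalemx1.
Qed.

(** Reduction of the square modulo the characteristic polynomial. *)
Lemma sqr_pencil (w c : R) : (A - w *: (A ^+ 2 - c *: 1%:M)) ^+ 2 =
  (1 - 2 * w ^+ 2 * c - w ^+ 2 * (m - 3 * a ^+ 2)) *: A ^+ 2 +
  (2 * w * c + 2 * w * (m - 3 * a ^+ 2) - w ^+ 2 * (a * (m - 2 * a ^+ 2))) *: A +
  (w ^+ 2 * c ^+ 2 + 2 * w * (a * (m - 2 * a ^+ 2))) *: 1%:M.
Proof.
have CH := Cayley_Hamilton A; rewrite cpA in CH.
move: (m - 3 * a ^+ 2) (a * (m - 2 * a ^+ 2)) CH => e d CH.
have -> : A - w *: (A ^+ 2 - c *: 1%:M) =
    horner_mx A ((- w)%:P * 'X^2 + 1%:P * 'X + (w * c)%:P).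
  rewrite horner_mx_quadratic; apply/matrixP => i j; rewrite !mxE; ring.
rewrite -rmorphXn -horner_mx_quadratic.
have -> : ((- w)%:P * 'X^2 + 1%:P * 'X + (w * c)%:P) ^+ 2 =
    ('X^3 + e%:P * 'X + d%:P) * (w%:P ^+ 2 * 'X - 2%:P * w%:P) +
    ((1 - 2 * w ^+ 2 * c - w ^+ 2 * e)%:P * 'X^2 +
     (2 * w * c + 2 * w * e - w ^+ 2 * d)%:P * 'X +
     (w ^+ 2 * c ^+ 2 + 2 * w * d)%:P).
  rewrite !(polyCD, polyCN, polyCM, polyC_exp, polyC1); ring.
by rewrite rmorphD rmorphM /= CH mul0r add0r.
Qed.

(** The pencil [A - w S(A)], with [S] the trace-free square, is closed under
    [S]; this is what reduces the matrix equation to two scalar ones. *)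
Lemma trfree_sqr_pencil (w : R) : trfree_sqr (A - w *: trfree_sqr A) =
  cubic a m w *: trfree_sqr A +
  (dcubic a m w / 3) *: (A - w *: trfree_sqr A).
Proof.
rewrite {1}/trfree_sqr sqr_pencil !mxtraceD !mxtraceZ trace1 trA trA2.
rewrite /trfree_sqr trA2 /cubic /dcubic.
by apply/matrixP => i j; rewrite !mxE; field.
Qed.

Lemma is_derive_within_comb (V : normedModType R) (D : set R) (f g : R -> R)
    (u v : V) (t df dg : R) : is_derive t 1 f df -> is_derive t 1 g dg ->
  is_derive_within D (fun t => f t *: u + g t *: v) t (df *: u + dg *: v).
Proof.
move=> /is_derive_quotient fdf /is_derive_quotient gdg.
rewrite /is_derive_within.
have -> : (fun s => (s - t)^-1 *: (f s *: u + g s *: v - (f t *: u + g t *: v)))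
  = (fun s => ((s - t)^-1 * (f s - f t)) *: u + ((s - t)^-1 * (g s - g t)) *: v).
  apply/funext => s; rewrite opprD addrACA -!scalerBl scalerDr.
  by rewrite !scalerA.
by apply: cvg_within_filter; apply: cvgD; apply: cvgZr_tmp.
Qed.

Lemma explicit_solution (T : R) (w phi : R -> R) : w 0 = 0 -> phi 0 = 1 ->
  (forall t, 0 <= t < T ->
     [/\ 0 < phi t, phi t ^+ 3 = cubic a m (w t),
         is_derive t 1 w (phi t ^+ 2) &
         is_derive t 1 phi (dcubic a m (w t) / 3)]) ->
  NS_solution A T%:E (fun t => (phi t)^-1 *: (A - w t *: trfree_sqr A)).
Proof.
move=> w0 phi0 clk; split; first by rewrite w0 phi0 invr1 scale0r subr0 scale1r.
pose f t := (phi t)^-1; pose g t := - (w t * (phi t)^-1).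
pose df t := - (phi t) ^- 2 * (dcubic a m (w t) / 3).
pose dg t := - (phi t - w t * (dcubic a m (w t) / 3) * (phi t) ^- 2).
have ME t : (phi t)^-1 *: (A - w t *: trfree_sqr A) =
    f t *: A + g t *: trfree_sqr A.
  by rewrite scalerBr scalerA /g scaleNr mulrC.
exists (fun t => df t *: A + dg t *: trfree_sqr A); last first.
  move=> t [t0]; rewrite lte_fin => tT.
  have [phi_gt0 phi3 _ _] := clk t (introT andP (conj t0 tT)).
  have pn0 : phi t != 0 by rewrite gt_eqF.
  split; last by rewrite mxtraceZ raddfB /= mxtraceZ trace_trfree_sqr trA; ring.
  rewrite -addrA -/(trfree_sqr _) trfree_sqrZ trfree_sqr_pencil -phi3.
  rewrite /df /dg; apply/matrixP => i j; rewrite !mxE; field.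
  by rewrite pn0.
split=> [t [t0]|]; first rewrite lte_fin => tT.
  have [phi_gt0 phi3 dw dphi] := clk t (introT andP (conj t0 tT)).
  rewrite (funext ME); apply: is_derive_within_comb.
    apply: (is_derive_eq (is_deriveV _ dphi)); last by rewrite /df /GRing.scale.
    by rewrite gt_eqF.
  have dV := is_deriveV (lt0r_neq0 phi_gt0) dphi.
  apply: (is_derive_eq (is_deriveN (is_deriveM dw dV))).
  rewrite /dg /GRing.scale /=; field.
  by rewrite gt_eqF.
apply: continuous_in_subspaceT => t; rewrite inE/= => -[t0]; rewrite lte_fin => tT.
have [phi_gt0 _ dw dphi] := clk t (introT andP (conj t0 tT)).
have wc := is_derive1_continuous dw.
have pc := is_derive1_continuous dphi.
have pV : {for t, continuous (fun u => (phi u) ^- 2)}.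
  apply: cvgV; first by rewrite expf_neq0 // gt_eqF.
  by apply: (@continuous_comp _ _ _ phi (fun x => x ^+ 2));
    [exact: pc|exact: exprn_continuous].
have cc : {for t, continuous (fun u => dcubic a m (w u) / 3)}.
  apply: cvgM; last exact: cvg_cst.
  apply: cvgB; apply: cvgM => //; first exact: cvg_cst; first exact: cvg_cst.
  by apply: (@continuous_comp _ _ _ w (fun x => x ^+ 2));
    [exact: wc|exact: exprn_continuous].
apply: cvgD; apply: cvgZr_tmp.
  by apply: cvgM => //; apply: cvgN.
apply: cvgN; apply: cvgB => //.
by apply: cvgM => //; apply: cvgM.
Qed.
End ExplicitSolution.

(** * Uniqueness *)

Section Uniqueness.
Variable R : realType.
Implicit Types (D : set R) (t b : R) (M : R -> 'M[R]_3).

Lemma is_derive_within_continuous (V : normedModType R) D (f : R -> V) t v :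
  is_derive_within D f t v -> f s @[s --> within D (nbhs t)] --> f t.
Proof.
move=> fv.
have lim0 : f t + (s - t) *: ((s - t)^-1 *: (f s - f t)) @[s --> within D t^']
    --> f t.
  rewrite -[X in _ --> X]addr0 -(scale0r v); apply: cvgD; first exact: cvg_cst.
  apply: cvgZ fv; rewrite -(subrr t); apply: cvgB; last exact: cvg_cst.
  by apply: cvg_within_filter; apply: nbhs_dnbhs.
apply/cvgrPdist_lt => e e0; move/cvgrPdist_lt : lim0 => /(_ _ e0) lim.
have {lim} : nbhs t (fun s => s != t -> D s ->
    `|f t - (f t + (s - t) *: ((s - t)^-1 *: (f s - f t)))| < e) by exact: lim.
apply: (@filterS _ (nbhs t)) => s /= + Ds.
have [->|st] := eqVneq s t; first by move=> _; rewrite subrr normr0.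
by move=> /(_ isT Ds); rewrite scalerA divff ?subr_eq0 // scale1r subrKC.
Qed.

Lemma NS_solution_continuous (M0 : 'M[R]_3) (T : \bar R) M b :
  NS_solution M0 T M -> (b%:E < T)%E -> {within `[0, b], continuous M}.
Proof.
move=> [_ [dM [dMP _] _]] bT; apply/subspace_continuousP => t.
rewrite /= in_itv/= => /andP[t0 tb].
have DT s : 0 <= s <= b -> time_interval T s.
  by case/andP=> s0 sb; split => //; apply: le_lt_trans bT; rewrite lee_fin.
have := is_derive_within_continuous (dMP t (DT t (introT andP (conj t0 tb)))).
apply: cvg_trans => P; apply: (@filterS _ (nbhs t)) => s + sI; apply.
by apply: DT; move: sI; rewrite /= in_itv.
Qed.

Lemma NS_solution_entry_derive (M0 : 'M[R]_3) (T : \bar R) M t i j :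
  NS_solution M0 T M -> 0 < t -> (t%:E < T)%E ->
  is_derive t 1 (fun s => M s i j) (- trfree_sqr (M t) i j).
Proof.
move=> [_ [dM [dMP _] eqM]] t0 tT.
have Dt : time_interval T t by split => //; exact: ltW.
have <- : dM t i j = - trfree_sqr (M t) i j.
  have [+ _] := eqM _ Dt; rewrite -addrA => /eqP; rewrite addr_eq0 => /eqP ->.
  by rewrite mxE.
have nD : \forall s \near t, time_interval T s.
  have nlt : \forall s \near t, (s%:E < T)%E.
    case: T tT {Dt eqM dMP} => [T tT|_|//].
      by apply: filterS (lt_nbhsl tT) => s; rewrite lte_fin.
    by apply: (@filterE _ (nbhs t)) => s; exact: ltry.
  near=> s; split; last by near: s.
  by apply: ltW; near: s; exact: lt_nbhsr.
apply/is_derive_quotient.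
have lim := cvg_comp _ _ (dMP _ Dt) (@coord_continuous R 3 3 i j (dM t)).
apply: cvg_trans (cvg_trans _ lim) => //; move=> P.
rewrite /nbhs /= => HP; have {HP} : t^' (fun s => time_interval T s ->
   P (((s - t)^-1 *: (M s - M t)) i j)) by exact: HP.
have nD' : t^' (time_interval T) by exact: nbhs_dnbhs.
apply: (@filterS2 _ t^' _ _ _ _ _ nD') => s Ds /(_ Ds).
by rewrite !mxE.
Unshelve. all: by end_near. Qed.

Lemma NS_solution_bounded (M0 : 'M[R]_3) (T : \bar R) M b :
  NS_solution M0 T M -> 0 <= b -> (b%:E < T)%E ->
  exists B, forall t i j, 0 <= t <= b -> `|M t i j| <= B.
Proof.
move=> Msol b0 bT; have Mc := NS_solution_continuous Msol bT.
have nc : {within `[0, b], continuous (fun t => `|M t|)}.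
  apply/subspace_continuousP => t tI; apply: cvg_norm.
  by move/subspace_continuousP : Mc; exact.
have [c _ cmax] := EVT_max b0 nc.
exists `|M c| => t i j tI; apply: (@le_trans _ _ `|M t|).
  rewrite [leRHS]mx_normrE; exact: (le_bigmax _ _ (i, j)).
by apply: cmax; rewrite in_itv.
Qed.

Lemma gronwall_nonpos (f df : R -> R) (K b : R) : {within `[0, b], continuous f} ->
  f 0 = 0 -> (forall t, 0 < t < b -> is_derive t 1 f (df t)) ->
  (forall t, 0 < t < b -> df t <= K * f t) ->
  forall t, 0 <= t <= b -> f t <= 0.
Proof.
move=> fc f0 dfE dfK t /andP[t0 tb].
pose g x := f x * expR (- K * x).
have dexp (x : R) :
    is_derive x 1 (fun x : R => expR (- K * x)) (expR (- K * x) * - K).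
  have dKx : is_derive x 1 (fun x : R => - K * x) (- K).
    by apply: (is_derive_eq (is_deriveZ (- K) (is_derive_id x 1)));
      rewrite /GRing.scale /= mulr1.
  exact: (is_derive1_comp (is_derive_expR _) dKx).
have dg x : 0 < x < b -> is_derive x 1 g ((df x - K * f x) * expR (- K * x)).
  move=> xI; apply: (is_derive_eq (is_deriveM (dfE _ xI) (dexp x))).
  rewrite /GRing.scale /=; ring.
have gt : g t <= g 0.
  apply: (@ler0_derive1_le_cc _ g 0 b); rewrite ?in_itv/= ?lexx ?t0 ?(le_trans t0) //.
  - by move=> x; rewrite in_itv/= => /dg/@ex_derive.
  - move=> x; rewrite in_itv/= => xI; have := dg _ xI => dgx.
    rewrite derive1E derive_val mulr_le0_ge0 ?expR_ge0 // subr_le0.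
    exact: dfK.
  - move=> x; apply: cvgM; first exact: fc.
    have ec : continuous (fun x : R => expR (- K * x)).
      by move=> y; exact: is_derive1_continuous (dexp y).
    exact: (@continuous_subspaceT _ _ `[0, b] _ ec).
by move: gt; rewrite /g f0 mul0r pmulr_lle0 // expR_gt0.
Qed.

(** Completing squares: with [|c| <= B] the quadratic form
    [B (x^2 + y^2) + 2 c x y] is nonnegative. *)
Lemma bilinear_bound (B c x y : R) : `|c| <= B ->
  - (x * (c * y)) <= B / 2 * (x ^+ 2 + y ^+ 2).
Proof.
move=> /ler_normlP[cB Bc]; rewrite -subr_ge0.
have -> : B / 2 * (x ^+ 2 + y ^+ 2) - - (x * (c * y)) =
    (B + c) / 4 * (x + y) ^+ 2 + (B - c) / 4 * (x - y) ^+ 2 by field.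
by rewrite addr_ge0 // mulr_ge0 ?sqr_ge0 //; lra.
Qed.

Definition frobenius_sqr (N : 'M[R]_3) : R := \sum_i \sum_j N i j ^+ 2.

Lemma frobenius_sqr_eq0 N : frobenius_sqr N <= 0 -> N = 0.
Proof.
move=> N0; have : frobenius_sqr N == 0.
  rewrite eq_le N0; apply: sumr_ge0 => i _.
  by apply: sumr_ge0 => j _; exact: sqr_ge0.
rewrite psumr_eq0 => [/allP N0'|i _]; last first.
  by apply: sumr_ge0 => j _; exact: sqr_ge0.
apply/matrixP => i j; rewrite mxE; apply/eqP.
have := N0' i (mem_index_enum i); rewrite /= psumr_eq0 => [/allP/(_ j)|k _].
  by rewrite mem_index_enum sqrf_eq0; exact.
exact: sqr_ge0.
Qed.

(** The left side is the derivative of [frobenius_sqr (N - N')] along two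
    solutions. The two multiples of the identity in [trfree_sqr] drop out,
    because the identity is orthogonal to the trace-free matrix [N - N'], and
    what remains of the difference of squares is [N D + D N'] with
    [D = N - N']. *)
Lemma trfree_sqr_lipschitz (N N' : 'M[R]_3) (B : R) :
  \tr N = 0 -> \tr N' = 0 ->
  (forall i j, `|N i j| <= B) -> (forall i j, `|N' i j| <= B) ->
  \sum_i \sum_j 2 * (N i j - N' i j) * - (trfree_sqr N i j - trfree_sqr N' i j)
  <= 12 * B * frobenius_sqr (N - N').
Proof.
move=> trN trN' bN bN'; set D := N - N'.
have trD : \tr D = 0 by rewrite raddfB /= trN trN' subrr.
pose c : R := 3^-1 * \tr (N ^+ 2) - 3^-1 * \tr (N' ^+ 2).
have SE i j : trfree_sqr N i j - trfree_sqr N' i j =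
    \sum_k N i k * D k j + \sum_k D i k * N' k j - c *+ (i == j).
  have -> : trfree_sqr N i j - trfree_sqr N' i j =
      (N *m D + D *m N' - c%:M) i j.
    rewrite -scalemx1 /D mulmxBr mulmxBl /trfree_sqr /c !expr2 -!mulmxE.
    rewrite !mxE; ring.
  by rewrite !mxE.
pose rhs i j := \sum_k B * (D i j ^+ 2 + D k j ^+ 2)
  + \sum_k B * (D i j ^+ 2 + D i k ^+ 2) + 2 * c * (D i j *+ (i == j)).
have -> : 12 * B * frobenius_sqr D = \sum_i \sum_j rhs i j.
  move: trD; rewrite /mxtrace /frobenius_sqr /rhs !sum3E /= ?mulr1n ?mulr0n => trD.
  have D22 : D 2 2 = - (D 0 0 + D 1 1).
    by move/eqP: trD; rewrite addrC addr_eq0 => /eqP.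
  ring: D22.
apply: ler_sum => i _; apply: ler_sum => j _.
have DE : N i j - N' i j = D i j by rewrite !mxE.
rewrite DE SE.
have -> : 2 * D i j * - (\sum_k N i k * D k j + \sum_k D i k * N' k j - c *+ (i == j))
  = \sum_k 2 * - (D i j * (N i k * D k j)) + \sum_k 2 * - (D i j * (N' k j * D i k))
    + 2 * c * (D i j *+ (i == j)).
  have -> : \sum_k D i k * N' k j = \sum_k N' k j * D i k.
    by apply: eq_bigr => k _; rewrite mulrC.
  rewrite -!mulr_sumr !sumrN -!mulr_sumr.
  have cD : D i j * (c *+ (i == j)) = c * (D i j *+ (i == j)).
    by rewrite !mulrnAr mulrC.
  rewrite mulrN mulrBr -[2 * D i j * (c *+ _)]mulrA cD; ring.
rewrite lerD2r lerD //; apply: ler_sum => k _.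
  have := bilinear_bound (D i j) (D k j) (bN i k); lra.
have := bilinear_bound (D i j) (D i k) (bN' k j); lra.
Qed.

Lemma NS_solution_unique (M0 : 'M[R]_3) (T T' : \bar R) M M' b :
  NS_solution M0 T M -> NS_solution M0 T' M' ->
  0 <= b -> (b%:E < T)%E -> (b%:E < T')%E -> M b = M' b.
Proof.
move=> sM sM' b0 bT bT'.
have [B1 bM] := NS_solution_bounded sM b0 bT.
have [B2 bM'] := NS_solution_bounded sM' b0 bT'.
pose B := Num.max B1 B2.
pose f s := frobenius_sqr (M s - M' s).
pose df s := \sum_i \sum_j 2 * (M s i j - M' s i j) *
  - (trfree_sqr (M s) i j - trfree_sqr (M' s) i j).
have tr0 N T1 t : NS_solution M0 T1 N -> 0 <= t <= b -> (b%:E < T1)%E ->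
    \tr (N t) = 0.
  move=> [_ [dN _ eqN]] /andP[t0 tb] bT1.
  have tT1 : (t%:E < T1)%E by apply: le_lt_trans bT1; rewrite lee_fin.
  by have [] := eqN t (conj t0 tT1).
have fE : f = \sum_i \sum_j (fun s => M s i j - M' s i j) ^+ 2.
  apply/funext => s; rewrite /f /frobenius_sqr fct_sumE; apply: eq_bigr => i _.
  rewrite fct_sumE; apply: eq_bigr => j _.
  by rewrite !mxE.
apply/eqP; rewrite -subr_eq0; apply/eqP/frobenius_sqr_eq0.
apply: (@gronwall_nonpos f df (12 * B) b); rewrite ?b0 ?lexx //.
- have ec N T1 i j : NS_solution M0 T1 N -> (b%:E < T1)%E ->
      {within `[0, b], continuous (fun s => N s i j)}.
    move=> sN bT1 s; apply: (@continuous_comp (subspace `[0, b]) _ _ N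
      (fun P : 'M[R]_3 => P i j)); last exact: coord_continuous.
    exact: (NS_solution_continuous sN bT1).
  have sc i j : {within `[0, b], continuous (fun s => (M s i j - M' s i j) ^+ 2)}.
    have dc : {within `[0, b], continuous (fun s => M s i j - M' s i j)}.
      by move=> s; apply: cvgB;
        [exact: (ec _ _ i j sM bT)|exact: (ec _ _ i j sM' bT')].
    move=> s; apply: (@continuous_comp (subspace `[0, b]) _ _
      (fun s => M s i j - M' s i j) (fun x : R => x ^+ 2)); last exact: exprn_continuous.
    exact: dc.
  have -> : f = fun s => \sum_i \sum_j (M s i j - M' s i j) ^+ 2.
    apply/funext => s; apply: eq_bigr => i _; apply: eq_bigr => j _.
    by rewrite !mxE.
  move=> s; apply: cvg_big => [|i _]; first exact: add_continuous.
  by apply: cvg_big => [|j _]; [exact: add_continuous|exact: sc].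
- case: sM sM' => M0E _ [M0E' _].
  rewrite /f M0E M0E' subrr /frobenius_sqr big1 // => i _.
  by rewrite big1 // => j _; rewrite !mxE expr0n.
- move=> t /andP[t0 tb].
  have tT : (t%:E < T)%E by apply: lt_trans bT; rewrite lte_fin.
  have tT' : (t%:E < T')%E by apply: lt_trans bT'; rewrite lte_fin.
  rewrite fE /df; apply: is_derive_sum => i; apply: is_derive_sum => j.
  have dM := NS_solution_entry_derive i j sM t0 tT.
  have dM' := NS_solution_entry_derive i j sM' t0 tT'.
  apply: (is_derive_eq (is_deriveX 2 (is_deriveB dM dM'))).
  rewrite /GRing.scale /= !fctE expr1; congr (_ * _).
  by rewrite opprK opprB addrC.
- move=> t /andP[/ltW t0 /ltW tb]; have tI : 0 <= t <= b by rewrite t0.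
  apply: trfree_sqr_lipschitz => [| |i j|i j].
  + exact: tr0 _ _ _ sM tI bT.
  + exact: tr0 _ _ _ sM' tI bT'.
  + by rewrite le_max bM.
  + by rewrite le_max bM' ?orbT.
Qed.
End Uniqueness.

(** * Real invariants of the spectrum and the blowup profile *)

Lemma conj_map_comb (F K : fieldType) (h : {rmorphism F -> K}) n
    (P Q : 'M[K]_n) (A B : 'M[F]_n) (x y : F) :
  P *m map_mx h (x *: A + y *: B) *m Q =
  h x *: (P *m map_mx h A *m Q) + h y *: (P *m map_mx h B *m Q).
Proof.
by rewrite map_mxD !map_mxZ mulmxDr mulmxDl -!scalemxAr -!scalemxAl.
Qed.

(** The residue [(3 / m) (a J - (J^2 - (tr J^2 / 3) I))] after replacing [J^2]
    by its value [a J - (m - 2 a^2) I + m E_00] from [jordan3_projector];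
    the terms in [J] then cancel. *)
Lemma projector_profile (F : numFieldType) (J : 'M[F]_3) (a m : F) : m != 0 ->
  (3 * a / m) *: J + (- (3 / m)) *: (a *: J - (m - 2 * a ^+ 2) *: 1%:M
    + m *: delta_mx 0 0 - (3^-1 * (6 * a ^+ 2 - 2 * m)) *: 1%:M) =
  blowup_profile F.
Proof.
move=> m0; apply/matrixP => i j; rewrite !mxE.
by have [->|->|->] := I3P i; have [->|->|->] := I3P j;
  rewrite /= ?mulr1n ?mulr0n; field; rewrite ?m0.
Qed.

Lemma blowup_profile_neq0 (F : numFieldType) : blowup_profile F != 0.
Proof.
apply/eqP => /matrixP/(_ 0 0); rewrite !mxE /= mulr1n => /eqP.
by rewrite oppr_eq0 pnatr_eq0.
Qed.

Section ComplexEmbedding.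
Variable R : realType.

HB.instance Definition _ := GRing.RMorphism.copy (@toC R) (real_complex R).

Lemma toC_continuous : continuous (@toC R).
Proof.
move=> x; apply/cvgrPdist_lt => e; rewrite ltcE => /andP[/eqP/= Ime Ree].
have /cvgrPdist_lt/(_ _ Ree) nearx : y @[y --> x] --> x by exact: cvg_id.
near=> y; rewrite -rmorphB ltcE normc_def /= Ime eqxx expr0n addr0 sqrtr_sqr /=.
by near: y; exact: nearx.
Unshelve. all: by end_near. Qed.

Variables (M0 : 'M[R]_3) (l1 l2 l3 : C R) (Q J : 'M[C R]_3).
Hypothesis trM0 : \tr M0 = 0.
Hypothesis cp : char_poly (map_mx (@toC R) M0) =
  ('X - l1%:P) * ('X - l2%:P) * ('X - l3%:P).
Hypothesis lt12 : complex.Re l1 < complex.Re l2.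
Hypothesis le23 : complex.Re l2 <= complex.Re l3.
Hypothesis jnf : jordan_normal_form (map_mx (@toC R) M0) Q J.
Hypothesis J00 : J 0 0 = l1.

Let l12 : l1 != l2.
Proof. by apply: contraTneq lt12 => ->; rewrite ltxx. Qed.
Let l13 : l1 != l3.
Proof. by apply: contraTneq (lt_le_trans lt12 le23) => ->; rewrite ltxx. Qed.

(** The spectrum of a real matrix is closed under conjugation, and no other
    eigenvalue has the real part of [l1]. *)
Lemma least_eigenvalue_real : complex.Im l1 = 0.
Proof.
have cpR : char_poly (map_mx (@toC R) M0) = map_poly (@toC R) (char_poly M0).
  by rewrite map_char_poly.
have : root (char_poly (map_mx (@toC R) M0)) (conjc l1).
  have := @complex_root_conj R (char_poly (map_mx (@toC R) M0)) l1.
  rewrite {1}cpR -map_poly_comp (eq_map_poly (g := @toC R)); last first.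
    by move=> x; exact: conjc_real.
  by rewrite -cpR => <-; rewrite cp !rootM root_XsubC eqxx.
rewrite cp !rootM !root_XsubC -orbA => /or3P[|/eqP e|/eqP e].
- by case: l1 => x y /eqP[] /eqP; rewrite eq_sym -addr_eq0 -mulr2n mulrn_eq0 => /eqP.
- by move: lt12; rewrite -e; case: l1 => x y /=; rewrite ltxx.
- by move: (lt_le_trans lt12 le23); rewrite -e; case: l1 => x y /=; rewrite ltxx.
Qed.

(** Writing [l2 = x2 + i y] and [l3 = x3 - i y], the product
    [m = (l2 + a) * (l3 + a)] has real part [(x2 + a) * (x3 + a) + y^2 > 0] and
    imaginary part [y * (x3 - x2)], which vanishes because the trace of the
    square of a real matrix is real. This covers real and conjugate pairs
    alike. *)
Lemma eigenvalue_parameters : exists a m : R,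
  [/\ 0 < a, 0 < m, l1 = toC (- a), l2 + l3 = toC a
    & l2 * l3 = toC (m - 2 * a ^+ 2)].
Proof.
have sum0 : l1 + l2 + l3 = 0.
  by rewrite -(jordan3_trace l12 l13 cp jnf J00) trace_map_mx trM0 rmorph0.
have sqr_real : complex.Im (l1 ^+ 2 + l2 ^+ 2 + l3 ^+ 2) = 0.
  by rewrite -(jordan3_trace_sqr l12 l13 cp jnf J00) -rmorphXn /= trace_map_mx.
have := least_eigenvalue_real; move: lt12 le23 sum0 sqr_real.
case: l1 l2 l3 => [x1 y1] [x2 y2] [x3 y3] /=.
move=> lt le /eqP; rewrite eq_complex /= => /andP[/eqP sx /eqP sy] + y10.
rewrite y10 => im.
have y3E : y3 = - y2 by move: sy; rewrite y10; lra.
have x1E : x1 = - (x2 + x3) by lra.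
exists (- x1), ((x2 - x1) * (x3 - x1) + y2 ^+ 2); split.
- lra.
- by rewrite ltr_wpDr ?sqr_ge0 // mulr_gt0 //; lra.
- by rewrite opprK.
- by apply/eqP; rewrite eq_complex /=; apply/andP; split; apply/eqP; lra.
- apply/eqP; rewrite eq_complex /=; apply/andP; split; apply/eqP.
    rewrite y3E x1E; ring.
  rewrite y3E; move: im; rewrite y3E; nra.
Qed.

Variables a m : R.
Hypotheses (m0 : 0 < m) (l1E : l1 = toC (- a)) (l23E : l2 + l3 = toC a).
Hypothesis l23M : l2 * l3 = toC (m - 2 * a ^+ 2).

Lemma char_poly_real : char_poly M0 =
  'X^3 + (m - 3 * a ^+ 2)%:P * 'X + (a * (m - 2 * a ^+ 2))%:P.
Proof.
apply: (map_poly_inj (@toC R)); rewrite map_char_poly cp.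
have -> : ('X - l1%:P) * ('X - l2%:P) * ('X - l3%:P) =
    ('X - l1%:P) * ('X^2 - (l2 + l3)%:P * 'X + (l2 * l3)%:P).
  rewrite polyCD polyCM; ring.
rewrite l23E l23M l1E !rmorphD !rmorphM /= ?map_polyXn !map_polyX !map_polyC /=.
rewrite !(rmorphN, rmorphB, rmorphM, rmorphXn, rmorph_nat) /=.
rewrite !map_polyC /=; ring.
Qed.

Lemma trace_sqr_real : \tr (M0 ^+ 2) = 6 * a ^+ 2 - 2 * m.
Proof.
apply: (@complexI R); rewrite -[LHS]/(toC _) -[RHS]/(toC _).
rewrite -trace_map_mx rmorphXn /= (jordan3_trace_sqr l12 l13 cp jnf J00).
have -> : l1 ^+ 2 + l2 ^+ 2 + l3 ^+ 2 =
    l1 ^+ 2 + (l2 + l3) ^+ 2 - 2 * (l2 * l3) by ring.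
rewrite l23E l23M l1E !(rmorphN, rmorphB, rmorphM, rmorphXn, rmorph_nat) /=; ring.
Qed.

Lemma blowup_profileE :
  toC (3 * a / m) *: (invmx Q *m map_mx (@toC R) M0 *m Q) +
  toC (- (3 / m)) *: (invmx Q *m map_mx (@toC R) (trfree_sqr M0) *m Q) =
  blowup_profile (C R).
Proof.
have [Qu _ AE] := jnf; have proj := jordan3_projector l12 l13 cp jnf J00.
have NE : invmx Q *m map_mx (@toC R) M0 *m Q = J.
  by rewrite AE -!mulmxA mulVmx // mulmx1 mulKmx.
have N2E : invmx Q *m (map_mx (@toC R) M0 *m map_mx (@toC R) M0) *m Q = J *m J.
  by rewrite AE !mulmxA mulVmx // mul1mx mulmxKV // mulmxKV.
have J2 : J *m J = toC a *: J - toC (m - 2 * a ^+ 2) *: 1%:M +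
    ((l1 - l2) * (l1 - l3)) *: delta_mx 0 0.
  rewrite -proj mulmxBl !mulmxBr -l23E -l23M -scalar_mxM mul_scalar_mx mul_mx_scalar.
  by apply/matrixP => i j; rewrite !mxE; ring.
have l1m : (l1 - l2) * (l1 - l3) = toC m.
  have -> : (l1 - l2) * (l1 - l3) = l1 ^+ 2 - (l2 + l3) * l1 + l2 * l3 by ring.
  rewrite l23E l23M l1E !(rmorphN, rmorphB, rmorphM, rmorphXn, rmorph_nat) /=; ring.
have KE : invmx Q *m map_mx (@toC R) (trfree_sqr M0) *m Q =
    J *m J - toC (3^-1 * (6 * a ^+ 2 - 2 * m)) *: 1%:M.
  rewrite /trfree_sqr trace_sqr_real expr2 -mulmxE map_mxB map_mxM map_mxZ map_mx1.
  by rewrite mulmxBr mulmxBl N2E -scalemxAr -scalemxAl mulmx1 mulVmx.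
rewrite NE KE J2 l1m.
have m0' : toC m != 0 by rewrite fmorph_eq0 gt_eqF.
rewrite !(rmorphN, rmorphB, rmorphM, rmorphXn, rmorph_nat, fmorphV) /=.
exact: projector_profile.
Qed.
End ComplexEmbedding.

(** * Blowup and maximality of the explicit solution *)

Section Maximal.
Variables (R : realType) (A : 'M[R]_3) (a m : R).
Hypotheses (a0 : 0 < a) (m0 : 0 < m).
Hypothesis cpA : char_poly A =
  'X^3 + (m - 3 * a ^+ 2)%:P * 'X + (a * (m - 2 * a ^+ 2))%:P.
Hypothesis trA : \tr A = 0.
Hypothesis trA2 : \tr (A ^+ 2) = 6 * a ^+ 2 - 2 * m.

Lemma blowup_solution : exists (T : R) (f g : R -> R),
  [/\ 0 < T, NS_solution A T%:E (fun t => f t *: A + g t *: trfree_sqr A),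
     (T - t) * f t @[t --> T^'-] --> 3 * a / m &
     (T - t) * g t @[t --> T^'-] --> - (3 / m)].
Proof.
have [T [w [phi [T0 [w0 phi0] clk wT phiT]]]] := clock a0 m0.
exists T, (fun t => (phi t)^-1), (fun t => - w t * (phi t)^-1); split => //.
  have := explicit_solution cpA trA trA2 w0 phi0 clk.
  congr NS_solution; apply/funext => t.
  by rewrite scalerBr scalerA -scaleNr mulNr mulrC.
have -> : - (3 / m) = - a^-1 * (3 * a / m) by field; rewrite !gt_eqF.
have -> : (fun t => (T - t) * (- w t * (phi t)^-1)) =
    (fun t => - w t * ((T - t) / phi t)) by apply/funext => t; ring.
by apply: cvgM phiT; exact: cvgN.
Qed.

(** A solution living longer would agree with the explicit one before [T], yet
    be continuous at [T], which contradicts the nonzero residue there. *)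
Lemma lifespan_le (T : R) (f g : R -> R) (T' : \bar R) (M' : R -> 'M[R]_3) :
  0 < T -> NS_solution A T%:E (fun t => f t *: A + g t *: trfree_sqr A) ->
  (T - t) * f t @[t --> T^'-] --> 3 * a / m ->
  (T - t) * g t @[t --> T^'-] --> - (3 / m) ->
  (3 * a / m) *: A + (- (3 / m)) *: trfree_sqr A != 0 ->
  NS_solution A T' M' -> (T' <= T%:E)%E.
Proof.
move=> T0 sol fT gT L0 sol'; rewrite leNgt; apply/negP => TT'.
move/eqP: L0; apply; apply/matrixP => i j.
have M'c : M' t i j @[t --> T^'-] --> M' T i j.
  have := NS_solution_continuous sol' TT' => /continuous_within_itvP.
  case=> // _ _ cT.
  exact: (cvg_comp _ (fun N : 'M[R]_3 => N i j) cT (@coord_continuous _ _ _ i j _)).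
have lim0 : (T - t) * M' t i j @[t --> T^'-] --> 0.
  rewrite -[X in _ --> X](mul0r (M' T i j)) -(subrr T); apply: cvgM M'c.
  apply: cvgB; first exact: cvg_cst.
  by apply: cvg_within_filter; exact: cvg_id.
have limL : (T - t) * M' t i j @[t --> T^'-] -->
    3 * a / m * A i j + - (3 / m) * trfree_sqr A i j.
  have lim : (T - t) * f t * A i j + (T - t) * g t * trfree_sqr A i j
      @[t --> T^'-] --> 3 * a / m * A i j + - (3 / m) * trfree_sqr A i j.
    by apply: cvgD; apply: cvgM; [exact: fT|exact: cvg_cst|exact: gT|exact: cvg_cst].
  apply: cvg_trans lim; apply: near_eq_cvg; near=> t.
  have tT : t < T by near: t; exact: nbhs_left_lt.
  have t0 : 0 <= t by near: t; exact: nbhs_left_ge.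
  have tT' : (t%:E < T')%E by apply: lt_trans TT'; rewrite lte_fin.
  rewrite -(NS_solution_unique sol sol' t0) ?lte_fin // !mxE; ring.
have := cvg_unique _ lim0 limL; rewrite !mxE => <- //.
Unshelve. all: by end_near. Qed.
End Maximal.

(** * Finite-time blowup with profile diag (-2, 1, 1) *)

Theorem theorem2p15 (R : realType) (M0 : 'M[R]_3)
    (trM0 : \tr M0 = 0)
    (lambda1 lambda2 lambda3 : C R)
    (eigenvalues : char_poly (map_mx (@toC R) M0) =
       ('X - lambda1%:P) * ('X - lambda2%:P) * ('X - lambda3%:P))
    (lt12 : complex.Re lambda1 < complex.Re lambda2)
    (le23 : complex.Re lambda2 <= complex.Re lambda3)
    (Q J : 'M[C R]_3)
    (jordan : jordan_normal_form (map_mx (@toC R) M0) Q J)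
    (first_entry : J 0 0 = lambda1) :
  (exists (Tmax : \bar R) (M : R -> 'M[R]_3), NS_maximal_solution M0 Tmax M) /\
  (forall (Tmax : \bar R) (M : R -> 'M[R]_3),
     NS_maximal_solution M0 Tmax M ->
     (Tmax < +oo)%E /\
     exists Jt : R -> 'M[C R]_3,
       (forall t : R, 0 <= t -> (t%:E < Tmax)%E ->
          map_mx (@toC R) (M t) = Q *m Jt t *m invmx Q) /\
       (forall i j : 'I_3,
          toC (fine Tmax - t) * Jt t i j @[t --> (fine Tmax)^'-] -->
          blowup_profile (C R) i j)).
Proof.
have [a [m [a0 m0 l1E l23E l23M]]] :=
  eigenvalue_parameters trM0 eigenvalues lt12 le23 jordan first_entry.
have cpM0 := char_poly_real eigenvalues l1E l23E l23M.
have trM0sqr := trace_sqr_real eigenvalues lt12 le23 jordan first_entry l1E l23E l23M.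
pose J1 : 'M[C R]_3 := invmx Q *m map_mx (@toC R) M0 *m Q.
pose J2 : 'M[C R]_3 := invmx Q *m map_mx (@toC R) (trfree_sqr M0) *m Q.
pose Jt (N : 'M[R]_3) : 'M[C R]_3 := invmx Q *m map_mx (@toC R) N *m Q.
have conjE (x y : R) : Jt (x *: M0 + y *: trfree_sqr M0) =
    toC x *: J1 + toC y *: J2 by exact: conj_map_comb.
have profileE := blowup_profileE eigenvalues lt12 le23 jordan first_entry m0
  l1E l23E l23M.
rewrite -/J1 -/J2 in profileE.
have [T [f [g [T0 sol fT gT]]]] := blowup_solution a0 m0 cpM0 trM0 trM0sqr.
have L0 : (3 * a / m) *: M0 + (- (3 / m)) *: trfree_sqr M0 != 0.
  apply/eqP => L0; have := conjE (3 * a / m) (- (3 / m)).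
  rewrite L0 profileE /Jt map_mx0 mulmx0 mul0mx => /esym/eqP.
  exact/negP/blowup_profile_neq0.
have life T' M' : NS_solution M0 T' M' -> (T' <= T%:E)%E.
  exact: lifespan_le T0 sol fT gT L0.
split.
  by exists T%:E, (fun t => f t *: M0 + g t *: trfree_sqr M0); split.
move=> Tmax M [_ solM maxM].
have TmaxE : Tmax = T%:E.
  by apply/eqP; rewrite eq_le (life _ _ solM) (maxM _ _ sol).
rewrite {}TmaxE in solM maxM *.
split; first exact: ltry.
exists (fun t => Jt (M t)); split=> [t _ _|i j].
  by case: jordan => Qu _ _; rewrite /Jt !mulmxA mulmxV // mul1mx mulmxK.
have entryE (x y : C R) : (x *: J1 + y *: J2) i j = x * J1 i j + y * J2 i j.
  by rewrite [LHS]mxE; congr (_ + _); rewrite [LHS]mxE.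
have mulE (c u v p q : C R) : c * (u * p + v * q) = c * u * p + c * v * q.
  by rewrite mulrDr !mulrA.
rewrite -profileE [fine _]/= entryE.
have toC_lim (u : R -> R) (l : R) : (T - t) * u t @[t --> T^'-] --> l ->
    toC ((T - t) * u t) @[t --> T^'-] --> toC l.
  by move=> ul; exact: (cvg_comp _ (@toC R) ul (@toC_continuous R l)).
have lim : toC ((T - t) * f t) * J1 i j + toC ((T - t) * g t) * J2 i j
    @[t --> T^'-] --> toC (3 * a / m) * J1 i j + toC (- (3 / m)) * J2 i j.
  by apply: cvgD; apply: cvgM; [exact: toC_lim|exact: cvg_cst
    |exact: toC_lim|exact: cvg_cst].
apply: cvg_trans lim; apply: near_eq_cvg; near=> t.
have tT : t < T by near: t; exact: nbhs_left_lt.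
have t0 : 0 <= t by near: t; exact: nbhs_left_ge.
rewrite -(NS_solution_unique sol solM t0) ?lte_fin // conjE.
rewrite entryE; apply: etrans (esym (mulE _ _ _ _ _)).
by congr (_ * _ + _ * _); exact: (rmorphM (@toC R)).
Unshelve. all: by end_near. Qed.
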